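(* Let $R$ be a finite ring with identity and $M$ a finite Frobenius $(R,R)$-bimodule. Then for all $n\in\mathbb{N}$ the Hamming weight on $M^n$ satisfies the MacWilliams extension property. In other words, for every left $R$-submodule $\mathcal{C}\subseteq M^n$ and every Hamming-weight-preserving left $R$-linear map $f:\mathcal{C}\longrightarrow M^n$ there exists a monomial matrix $A\in\mathrm{Mon}_n(R)$ such that $f(v)=vA$ for all $v\in\mathcal{C}$.
   Context: For a finite ring $R$ with identity, the character group $\widehat{R}=\mathrm{Hom}((R,+),\mathbb{C}^* )$ is an $(R,R)$-bimodule via $(r\cdot\chi)(a)=\chi(ar)$ and $(\chi\cdot r)(a)=\chi(ra)$. A finite $(R,R)$-bimodule $M$ is called a Frobenius bimodule if ${}_RM\cong{}_R\widehat{R}$ as left $R$-modules and $M_R\cong\widehat{R}_R$ as right $R$-modules. Elements of $M^n$ are row vectors; for a matrix $A\in R^{n\times n}$ and $v\in M^n$, the product $vA\in M^n$ is defined in the usual way using the right $R$-module structure of $M$. $\mathrm{Mon}_n(R)$ is the group of matrices in $\mathrm{GL}_n(R)$ with exactly one nonzero entry in each row and each column (these entries are then units). The Hamming weight on $M^n$ is $\mathrm{wt}_{\mathrm H}(v_1,\ldots,v_n)=|\{i\mid v_i\neq0\}|$. For a weight function $\mathrm{wt}$ (a map to $\mathbb{C}$ with $\mathrm{wt}(0)=0$) on a left $R$-module $V$, a linear map $f:\mathcal{C}\to V$ on a submodule $\mathcal{C}\subseteq V$ is $\mathrm{wt}$-preserving if $\mathrm{wt}(f(v))=\mathrm{wt}(v)$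 for all $v\in\mathcal{C}$; the weight satisfies the MacWilliams extension property if for every submodule $\mathcal{C}\subseteq V$ each $\mathrm{wt}$-preserving linear map $f:\mathcal{C}\to V$ can be extended to a $\mathrm{wt}$-preserving linear map on $V$. *)

(* Defs.v *)
From HB Require Import structures.
From mathcomp Require Import all_boot all_order all_algebra.
From mathcomp Require Import reals complex.

Set Implicit Arguments.
Unset Strict Implicit.
Unset Printing Implicit Defensive.

Import GRing.Theory.
Local Open Scope ring_scope.
Local Open Scope complex_scope.

HB.mixin Record Lmodule_isBimodule (R : nzRingType) M of GRing.Lmodule R M := {
  rscale : M -> R -> M;
  rscalerA : forall x a b, rscale (rscale x a) b = rscale x (a * b);
  rscaler1 : forall x, rscale x 1 = x;
  rscalerDl : forall a x y, rscale (x + y) a = rscale x a + rscale y a;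
  rscalerDr : forall x a b, rscale x (a + b) = rscale x a + rscale x b;
  scaler_rscale : forall a x b, a *: rscale x b = rscale (a *: x) b
}.

#[short(type="bimodType")]
HB.structure Definition Bimodule (R : nzRingType) :=
  {M of GRing.Lmodule R M & Lmodule_isBimodule R M}.

#[short(type="finBimodType")]
HB.structure Definition FinBimodule (R : nzRingType) :=
  {M of FinRing.Lmodule R M & Lmodule_isBimodule R M}.

Notation "x :* a" := (rscale x a) : ring_scope.

Section CharacterGroup.
Variables (K : realType) (R : finNzRingType).

Definition is_char (chi : {ffun R -> K[i]}) : bool :=
  [forall a, chi a != 0] && [forall a, forall b, chi (a + b) == chi a * chi b].

Record char_group :=
  CharGroup { char_val :> {ffun R -> K[i]}; char_valP : is_char char_val }.

HB.instance Definition _ := [isSub for char_val].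
HB.instance Definition _ := [Choice of char_group by <:].

Implicit Types chi psi : char_group.

Fact char_neq0 chi a : chi a != 0.
Proof. by have /andP[/forallP] := char_valP chi. Qed.

Fact char_add chi a b : chi (a + b) = chi a * chi b.
Proof. by have /andP[_ /forallP/(_ a)/forallP/(_ b)/eqP] := char_valP chi. Qed.

Fact is_charP (f : R -> K[i]) :
  (forall a, f a != 0) -> (forall a b, f (a + b) = f a * f b) ->
  is_char (finfun f).
Proof.
move=> f0 fD; apply/andP; split; apply/forallP=> a; first by rewrite ffunE.
by apply/forallP=> b; rewrite !ffunE fD.
Qed.

Definition mk_char f f0 fD : char_group := CharGroup (@is_charP f f0 fD).

Fact mk_charE f f0 fD a : @mk_char f f0 fD a = f a.
Proof. exact: ffunE. Qed.

Fact charP chi psi : (forall a, chi a = psi a) -> chi = psi.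
Proof. by move=> eq_cp; apply/val_inj/ffunP. Qed.

(* The group law on characters is pointwise multiplication; it is written
   additively because modules are additive groups in the library. *)
Program Definition char_zero : char_group := @mk_char (fun=> 1) _ _.
Next Obligation. exact: oner_neq0. Qed.
Next Obligation. by rewrite mulr1. Qed.

Program Definition char_addg chi psi := @mk_char (fun a => chi a * psi a) _ _.
Next Obligation. by rewrite mulf_neq0 ?char_neq0. Qed.
Next Obligation. by rewrite !char_add mulrACA. Qed.

Program Definition char_opp chi := @mk_char (fun a => (chi a)^-1) _ _.
Next Obligation. by rewrite invr_eq0 char_neq0. Qed.
Next Obligation. by rewrite char_add invfM. Qed.

Program Definition char_scale (r : R) chi := @mk_char (fun a => chi (a * r)) _ _.
Next Obligation. exact: char_neq0. Qed.
Next Obligation. by rewrite mulrDl char_add. Qed.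

Program Definition char_rscale chi (r : R) := @mk_char (fun a => chi (r * a)) _ _.
Next Obligation. exact: char_neq0. Qed.
Next Obligation. by rewrite mulrDr char_add. Qed.

Fact char_addgA : associative char_addg.
Proof. by move=> x y z; apply/charP=> a; rewrite !mk_charE mulrA. Qed.
Fact char_addgC : commutative char_addg.
Proof. by move=> x y; apply/charP=> a; rewrite !mk_charE mulrC. Qed.
Fact char_add0g : left_id char_zero char_addg.
Proof. by move=> x; apply/charP=> a; rewrite !mk_charE mul1r. Qed.
Fact char_addNg : left_inverse char_zero char_opp char_addg.
Proof. by move=> x; apply/charP=> a; rewrite !mk_charE mulVf ?char_neq0. Qed.

HB.instance Definition _ := GRing.isZmodule.Build char_group
  char_addgA char_addgC char_add0g char_addNg.

Fact char_scalerA r s chi :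
  char_scale r (char_scale s chi) = char_scale (r * s) chi.
Proof. by apply/charP=> a; rewrite !mk_charE mulrA. Qed.
Fact char_scale1r : left_id 1 char_scale.
Proof. by move=> x; apply/charP=> a; rewrite !mk_charE mulr1. Qed.
Fact char_scalerDr : right_distributive char_scale +%R.
Proof. by move=> r x y; apply/charP=> a; rewrite !mk_charE. Qed.
Fact char_scalerDl chi :
  {morph char_scale^~ chi : r s / r + s >-> r + s}.
Proof. by move=> r s; apply/charP=> a; rewrite !mk_charE mulrDr char_add. Qed.

HB.instance Definition _ := GRing.Zmodule_isLmodule.Build R char_group
  char_scalerA char_scale1r char_scalerDr char_scalerDl.

Fact char_rscalerA chi r s :
  char_rscale (char_rscale chi r) s = char_rscale chi (r * s).
Proof. by apply/charP=> a; rewrite !mk_charE mulrA. Qed.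
Fact char_rscaler1 chi : char_rscale chi 1 = chi.
Proof. by apply/charP=> a; rewrite !mk_charE mul1r. Qed.
Fact char_rscalerDl r chi psi :
  char_rscale (chi + psi) r = char_rscale chi r + char_rscale psi r.
Proof. by apply/charP=> a; rewrite !mk_charE. Qed.
Fact char_rscalerDr chi r s :
  char_rscale chi (r + s) = char_rscale chi r + char_rscale chi s.
Proof. by apply/charP=> a; rewrite !mk_charE mulrDl char_add. Qed.
Fact char_scaler_rscale r chi s :
  r *: char_rscale chi s = char_rscale (r *: chi) s.
Proof. by apply/charP=> a; rewrite !mk_charE mulrA. Qed.

HB.instance Definition _ := Lmodule_isBimodule.Build R char_group
  char_rscalerA char_rscaler1 char_rscalerDl char_rscalerDr char_scaler_rscale.

End CharacterGroup.

Arguments char_group : clear implicits.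

(* The left and the right isomorphism need not be given by the same map. *)
Definition frobenius_bimodule (K : realType) (R : finNzRingType)
    (M : finBimodType R) : Prop :=
  (exists phi : {linear M -> char_group K R}, bijective phi) /\
  (exists2 psi : {additive M -> char_group K R},
     bijective psi & forall x r, psi (x :* r) = psi x :* r).

Section Monomial.
Variables (R : nzRingType) (n : nat).

(* The library's unitmx requires a commutative ring of coefficients. *)
Definition in_GL (A : 'M[R]_n) : Prop :=
  exists2 B : 'M[R]_n, A *m B = 1%:M & B *m A = 1%:M.

Definition in_Mon (A : 'M[R]_n) : Prop :=
  [/\ in_GL A,
      forall i, #|[set j | A i j != 0]| = 1%N
    & forall j, #|[set i | A i j != 0]| = 1%N].

End Monomial.

(* Vectors over a module M are finite functions, since the library puts a
   scalar multiplication on matrices only when the entries are in a ring. *)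
Definition vec_mulmx (R : nzRingType) (M : bimodType R) n
    (v : {ffun 'I_n -> M}) (A : 'M[R]_n) : {ffun 'I_n -> M} :=
  [ffun j => \sum_i v i :* A i j].

Section Weights.
Variables (K : realType) (R : nzRingType).

Record weight (V : lmodType R) :=
  Weight { weight_fun :> V -> K[i]; weight0 : weight_fun 0 = 0 }.

Section Extension.
Variable V : lmodType R.

(* A map defined on a submodule C is represented by a map on V, whose values
   outside C are irrelevant. *)
Definition linear_on (C : {pred V}) (f : V -> V) : Prop :=
  forall a, {in C &, forall u v, f (a *: u + v) = a *: f u + f v}.

Definition preserving_on (wt : weight V) (C : {pred V}) (f : V -> V) : Prop :=
  {in C, forall v, wt (f v) = wt v}.

Definition MacWilliams_extension (wt : weight V) : Prop :=
  forall (C : {pred V}) (f : V -> V),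
    GRing.submod_closed C -> linear_on C f -> preserving_on wt C f ->
  exists2 g : {linear V -> V}, {in C, g =1 f} & forall v, wt (g v) = wt v.

End Extension.

Section Hamming.
Variables (M : lmodType R) (n : nat).

Definition wtH (v : {ffun 'I_n -> M}) : nat := #|[set i | v i != 0]|.

Fact wtH0 : (wtH 0)%:R = 0 :> K[i].
Proof.
rewrite /wtH (_ : [set i | _] = set0) ?cards0 //.
by apply/setP=> i; rewrite !inE ffunE eqxx.
Qed.

Definition hamming_weight : weight {ffun 'I_n -> M} :=
  @Weight _ (fun v => (wtH v)%:R) wtH0.

End Hamming.
End Weights.

Arguments hamming_weight K {R} M n.

(* Main.v *)
(** Composing a left isomorphism from M to the character group with evaluation
    at 1 yields a character chi of M whose kernel contains no nonzero left or
    right submodule.  By orthogonality of the characters chi (_ r), preservation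
    of the Hamming weight says that the coordinate functions l_i of C and those,
    m_j, of f satisfy {l_i r | i, r in R} = {m_j r | j, r in R} as multisets.
    Counting by cyclic right submodules, largest first, the families (l_i R) and
    (m_j R) agree up to a permutation, and generators of the same cyclic module
    over a finite ring differ by a unit. *)

Require Import Defs.
From HB Require Import structures.
From mathcomp Require Import all_boot all_order all_algebra all_fingroup.
From mathcomp Require Import reals complex.

Set Implicit Arguments.
Unset Strict Implicit.
Unset Printing Implicit Defensive.

Import GRing.Theory Num.Theory.
Local Open Scope ring_scope.

(** * Right scalar multiplication and bimodules of functions *)

Lemma rscaler0 (R : nzRingType) (M : bimodType R) (x : M) : x :* 0 = 0.
Proof. by apply: (addIr (x :* 0)); rewrite -rscalerDr !add0r. Qed.

Lemma rscale0r (R : nzRingType) (M : bimodType R) (a : R) : (0 : M) :* a = 0.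
Proof. by apply: (addIr ((0 : M) :* a)); rewrite -rscalerDl !add0r. Qed.

Lemma rscalerNr (R : nzRingType) (M : bimodType R) (x : M) (a : R) :
  x :* (- a) = - (x :* a).
Proof. by apply: (addIr (x :* a)); rewrite -rscalerDr !addNr rscaler0. Qed.

Section PointwiseBimodule.
Variables (R : nzRingType) (T : finType) (M : bimodType R).
Implicit Types x y : {ffun T -> M}.

Definition ffun_rscale x (a : R) : {ffun T -> M} := [ffun t => x t :* a].

Fact ffun_rscalerA x a b :
  ffun_rscale (ffun_rscale x a) b = ffun_rscale x (a * b).
Proof. by apply/ffunP=> t; rewrite !ffunE rscalerA. Qed.
Fact ffun_rscaler1 x : ffun_rscale x 1 = x.
Proof. by apply/ffunP=> t; rewrite !ffunE rscaler1. Qed.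
Fact ffun_rscalerDl a x y :
  ffun_rscale (x + y) a = ffun_rscale x a + ffun_rscale y a.
Proof. by apply/ffunP=> t; rewrite !ffunE rscalerDl. Qed.
Fact ffun_rscalerDr x a b :
  ffun_rscale x (a + b) = ffun_rscale x a + ffun_rscale x b.
Proof. by apply/ffunP=> t; rewrite !ffunE rscalerDr. Qed.
Fact ffun_scaler_rscale a x b :
  a *: ffun_rscale x b = ffun_rscale (a *: x) b.
Proof. by apply/ffunP=> t; rewrite !ffunE scaler_rscale. Qed.

HB.instance Definition _ := Lmodule_isBimodule.Build R {ffun T -> M}
  ffun_rscalerA ffun_rscaler1 ffun_rscalerDl ffun_rscalerDr ffun_scaler_rscale.

End PointwiseBimodule.

HB.instance Definition _ (R : nzRingType) (T : finType) (M : finBimodType R) :=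
  Bimodule.on {ffun T -> M}.

(** The equations form a triangular system: by strong induction on [d], all terms of the one at [J]
    except the diagonal one agree, and the positive weight [w J] cancels. It serves for right ideals
    under inclusion and for cyclic submodules under reverse inclusion. *)
Lemma triangular_counts (T : finType) (P : pred T) (e : rel T)
    (d w N N' : T -> nat) :
    (forall K, ~~ P K -> N K = N' K) ->
    (forall J, P J -> e J J && (0 < w J)%N) ->
    (forall J K, P J -> e J K -> K != J -> (d K < d J)%N) ->
    (forall J, P J -> \sum_(K | e J K) N K * w K = \sum_(K | e J K) N' K * w K)%N ->
  N =1 N'.
Proof.
move=> NnP ew ed eqN J; have [m] := ubnP (d J); elim: m J => // m IHm J ltJm.
have [PJ | /NnP//] := boolP (P J); have /andP[eJJ wJ] := ew J PJ.
have := eqN J PJ; rewrite (bigD1 J) //= [RHS](bigD1 J) //=.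
rewrite [X in (_ + X)%N = _ -> _](_ : _ = \sum_(K | e J K && (K != J)) N' K * w K)%N.
  by move/addIn/eqP; rewrite eqn_pmul2r // => /eqP.
apply: eq_bigr => K /andP[eJK neqKJ]; rewrite IHm //.
exact: leq_trans (ed J K PJ eJK neqKJ) _.
Qed.

(** * Cyclic right submodules and their generators *)

Section CyclicSubmodules.
Variables (R : finNzRingType) (X : finBimodType R).
Implicit Types (x y z : X) (r s : R).

(** Left multiplication by [s] is injective, hence bijective by finiteness; so [s] has a right
    inverse, which must be [r]. *)
Lemma mulr1_eq1C r s : r * s = 1 -> s * r = 1.
Proof.
move=> rs1; have inj_s : injective ( *%R s).
  by move=> t t' /(congr1 ( *%R r)); rewrite !mulrA rs1 !mul1r.
have [s' _ s's] := injF_bij inj_s.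
have <- : s' 1 = r by have /(congr1 ( *%R r)) := s's 1; rewrite mulrA rs1 mul1r mulr1.
exact: s's.
Qed.

(** Translation by the particular solution [r0] carries the homogeneous solutions in [J] onto the
    others. *)
Lemma card_rscale_eq (J : {set R}) x z r0 :
    GRing.zmod_closed J -> r0 \in J -> x :* r0 = z ->
  #|[set r in J | x :* r == z]| = #|[set r in J | x :* r == 0]|.
Proof.
move=> [J0 JB] Jr0 xr0; rewrite -[RHS](card_imset _ (addrI r0)); congr #|pred_of_set _|.
have JD a b : a \in J -> b \in J -> a + b \in J.
  by move=> Ja Jb; rewrite -[b]opprK -[- b]sub0r !JB.
apply/setP=> r; rewrite inE; apply/andP/imsetP.
  case=> Jr /eqP xr; exists (r - r0); last by rewrite addrC subrK.
  by rewrite inE JB // rscalerDr rscalerNr xr xr0 subrr eqxx.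
case=> s; rewrite inE => /andP[Js /eqP xs] ->.
by rewrite JD // rscalerDr xr0 xs addr0.
Qed.

Definition rspan x : {set X} := [set x :* r | r in R].
Definition ridl r : {set R} := [set r * s | s in R].

Lemma mem_rspan x : x \in rspan x.
Proof. by apply/imsetP; exists 1; rewrite ?rscaler1. Qed.

Lemma rspan_sub x y : (rspan x \subset rspan y) = (x \in rspan y).
Proof.
apply/subsetP/idP => [-> //|]; first exact: mem_rspan.
move=> /imsetP[r _ ->] z /imsetP[s _ ->]; apply/imsetP.
by exists (r * s); rewrite ?rscalerA.
Qed.

Lemma mem_ridl r : r \in ridl r.
Proof. by apply/imsetP; exists 1; rewrite ?mulr1. Qed.

Lemma ridlM r s t : s \in ridl r -> s * t \in ridl r.
Proof. by case/imsetP=> u _ ->; rewrite -mulrA imset_f. Qed.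

Lemma ridl_sub r s : (ridl s \subset ridl r) = (s \in ridl r).
Proof.
apply/subsetP/idP => [-> //|rs t /imsetP[u _ ->]]; first exact: mem_ridl.
exact: ridlM.
Qed.

Lemma ridl_zmod_closed r : GRing.zmod_closed (ridl r).
Proof.
split=> [|s t /imsetP[u _ ->] /imsetP[v _ ->]].
  by apply/imsetP; exists 0; rewrite ?mulr0.
by rewrite -mulrBr imset_f.
Qed.

(* The number of solutions r of x r = z in a right ideal J is the same for
   all z generating xR, so by Moebius inversion over J the same holds for the
   number of solutions with r R = J; for J = R and z = x there is r = 1. *)
Lemma rspan_eq_unit x y : rspan x = rspan y ->
  exists2 u, x :* u = y & exists2 v, u * v = 1 & v * u = 1.
Proof.
move=> eqxy; pose N z (J : {set R}) := #|[set r | (x :* r == z) && (ridl r == J)]|.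
have sumN z t : (\sum_(K : {set R} | K \subset ridl t) N z K * 1)%N
    = #|[set r in ridl t | x :* r == z]|.
  rewrite -sum1_card (partition_big ridl (fun K : {set R} => K \subset ridl t)) /=.
    apply: eq_bigr => K sKJ; rewrite muln1 /N -sum1_card.
    apply: eq_bigl => r; rewrite !inE -ridl_sub.
    by case: (ridl r =P K) => [->|_]; rewrite ?andbF // sKJ /= andbT.
  by move=> r; rewrite inE ridl_sub => /andP[].
(* A right ideal absorbs right multiplication, so solvability inside it depends only on the span of
   the right-hand side. *)
have solvable z z' t r : rspan z = rspan z' -> r \in ridl t -> x :* r = z ->
  exists2 s, s \in ridl t & x :* s = z'.
- move=> eqzz' Jr xr; have := mem_rspan z'; rewrite -eqzz' => /imsetP[a _ ->].
  by exists (r * a); [exact: ridlM | rewrite -rscalerA xr].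
have eqN : N x =1 N y.
  apply: (@triangular_counts _ (fun J => [exists r, J == ridl r])
    (fun J K => K \subset J) (fun J => #|J|) (fun=> 1%N)) => [K|J _|J K _ sKJ neKJ|J].
  - move/existsPn=> nK; rewrite /N !eq_card0 // => r;
      by rewrite !inE (eq_sym _ K) (negPf (nK r)) andbF.
  - by rewrite subxx.
  - by rewrite proper_card // properEneq neKJ.
  case/existsP=> t /eqP->; rewrite !sumN.
  have [/existsP[r /andP[Jr /eqP xr]] | no_r] :=
    boolP [exists r, (r \in ridl t) && (x :* r == x)].
    have [s Js xs] := solvable _ _ _ _ eqxy Jr xr.
    rewrite (card_rscale_eq (ridl_zmod_closed t) Jr xr).
    by rewrite (card_rscale_eq (ridl_zmod_closed t) Js xs).
  rewrite !eq_card0 // => r; rewrite inE; apply: contraNF no_r => /andP[Jr /eqP xr].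
    have [s Js xs] := solvable _ _ _ _ (esym eqxy) Jr xr.
    by apply/existsP; exists s; rewrite Js xs /=.
  by apply/existsP; exists r; rewrite Jr xr /=.
have: (0 < N y (ridl 1%R))%N.
  by rewrite -eqN; apply/card_gt0P; exists 1; rewrite inE rscaler1 !eqxx.
case/card_gt0P=> u; rewrite inE => /andP[/eqP xu /eqP idu]; exists u => //.
(* [u] generates the whole ring as a right ideal, so it has a right inverse, two-sided by
   finiteness. *)
have: 1 \in ridl u by rewrite idu mem_ridl.
by case/imsetP=> v _ uv; exists v => //; apply: mulr1_eq1C.
Qed.

(** The fibres of [r |-> x :* r] over its image are cosets of one annihilator, so the count depends
    on [x] and [z] only through their spans. *)
Lemma card_rscale_solutions x z :
  #|[set r | x :* r == z]| =
    if rspan z \subset rspan x then (#|R| %/ #|rspan x|)%N else 0%N.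
Proof.
have RT : GRing.zmod_closed [set: R] by split=> [|a b]; rewrite !inE.
have cardE y : y \in rspan x -> #|[set r | x :* r == y]| = #|[set r | x :* r == 0]|.
  case/imsetP=> r0 _ ->.
  have := card_rscale_eq RT (in_setT r0) (erefl (x :* r0)).
  by rewrite !setIdE !setTI.
rewrite rspan_sub; case: ifPn => [xz | nxz]; last first.
  apply/eqP; rewrite cards_eq0; apply/eqP/setP=> r; rewrite !inE.
  by apply: contraNF nxz => /eqP<-; rewrite imset_f.
have -> : #|R| = (#|rspan x| * #|[set r | x :* r == z]|)%N.
  rewrite -[LHS]sum1_card (partition_big (fun r => x :* r) (mem (rspan x))) /=.
    rewrite -sum_nat_const; apply: eq_bigr => y xy.
    by rewrite cardE // -(cardE y) // -sum1dep_card.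
  by move=> r _; rewrite imset_f.
by rewrite mulKn //; apply/card_gt0P; exists x; apply: mem_rspan.
Qed.

(** Grouping indices by span turns the hypothesis into a triangular system for the multiplicities of
    cyclic submodules. These therefore agree, which yields the permutation. *)
Lemma rspan_matching n (l m : 'I_n -> X) :
    (forall h, (exists i, h = l i) \/ (exists i, h = m i) ->
      \sum_i #|[set r | l i :* r == h]| = \sum_i #|[set r | m i :* r == h]|)%N ->
  exists sigma : {perm 'I_n}, forall j, rspan (l (sigma j)) = rspan (m j).
Proof.
move=> eq_sum; pose N (k : 'I_n -> X) (J : {set X}) := #|[set i | rspan (k i) == J]|.
have sumN k h : \sum_i #|[set r | k i :* r == h]|
    = (\sum_(K : {set X} | rspan h \subset K) N k K * (#|R| %/ #|K|))%N.
  under eq_bigr do rewrite card_rscale_solutions.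
  rewrite -big_mkcond /= (partition_big (rspan \o k) (fun K : {set X} => rspan h \subset K)) //=.
  apply: eq_bigr => K shK; rewrite /N -sum_nat_const; under [RHS]eq_bigl do rewrite inE.
  apply: eq_big => [i|i /andP[_ /eqP->] //]; case: eqP => [->|_]; by rewrite ?shK ?andbF.
have eqN : N l =1 N m.
  (* Larger submodules are settled first, hence the size of the complement as rank. *)
  apply: (@triangular_counts _
    (fun J => [exists i, (J == rspan (l i)) || (J == rspan (m i))])
    (fun J K => J \subset K) (fun J => #|~: J|) (fun K => #|R| %/ #|K|)%N).
  - move=> K /existsPn nK; rewrite /N !eq_card0 // => i; rewrite !inE (eq_sym _ K);
      by have := nK i; rewrite negb_or => /andP[/negPf ? /negPf ?].
  - move=> J PJ; rewrite subxx /=.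
    have{PJ} [h ->] : exists h, J = rspan h.
      by case/existsP: PJ => i /orP[]/eqP->; eexists.
    have h0 : (0 < #|rspan h|)%N by apply/card_gt0P; exists h; apply: mem_rspan.
    (* A cyclic submodule is an image of [R], so its size is at most [#|R|] and the weight is
       positive. *)
    by rewrite divn_gt0 // leq_imset_card.
  - by move=> J K _ sJK neKJ; rewrite proper_card // properC properEneq eq_sym neKJ.
  move=> J /existsP[i PJ].
  have [h Ph ->] :
      exists2 h, (exists i, h = l i) \/ (exists i, h = m i) & J = rspan h.
    by case/orP: PJ => /eqP->; [exists (l i) | exists (m i)] => //;
      [left | right]; exists i.
  by rewrite -!sumN eq_sum.
have /tuple_permP[sigma Esigma] :
    perm_eq [tuple rspan (m i) | i < n] [tuple rspan (l i) | i < n].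
  have countE k J : count_mem J [tuple rspan (k i) | i < n] = N k J.
    rewrite /N -sum1_count big_map -sum1dep_card.
    by rewrite -[tval (ord_tuple n)]/(enum 'I_n) big_enum_cond.
  by apply/allP=> J _ /=; rewrite !countE eqN.
exists sigma => j; have := congr1 (fun t : seq _ => nth set0 t j) Esigma.
by rewrite -!tnth_nth !tnth_mktuple.
Qed.

End CyclicSubmodules.

Lemma rspan_family_unit (R : finNzRingType) (X : finBimodType R) n
    (l m : 'I_n -> X) :
    (forall h, (exists i, h = l i) \/ (exists i, h = m i) ->
      \sum_i #|[set r | l i :* r == h]| = \sum_i #|[set r | m i :* r == h]|)%N ->
  exists (sigma : {perm 'I_n}) (u v : 'I_n -> R),
    forall j, [/\ m j = l (sigma j) :* u j, u j * v j = 1 & v j * u j = 1].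
Proof.
move=> /rspan_matching[sigma Esigma].
(* A boolean property of pairs lets [xchoose] pick the unit and its inverse as functions of [j]. *)
have uE j : exists uv : R * R,
    [&& m j == l (sigma j) :* uv.1, uv.1 * uv.2 == 1 & uv.2 * uv.1 == 1].
  have [u xu [v uv vu]] := rspan_eq_unit (Esigma j).
  by exists (u, v); rewrite /= xu uv vu !eqxx.
exists sigma, (fun j => (xchoose (uE j)).1), (fun j => (xchoose (uE j)).2) => j.
by have /and3P[/eqP ? /eqP ? /eqP ?] := xchooseP (uE j).
Qed.

(** * Monomial matrices *)

Section Monomial.
Variables (R : nzRingType) (n : nat) (sigma : {perm 'I_n}) (u v : 'I_n -> R).
Hypotheses (uv : forall j, u j * v j = 1) (vu : forall j, v j * u j = 1).

Definition mon_mx : 'M[R]_n := \matrix_(i, j) (if i == sigma j then u j else 0).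

Lemma left_unit_neq0 j : u j != 0.
Proof.
apply/eqP=> uj0; have /esym/eqP := uv j.
by rewrite uj0 mul0r oner_eq0.
Qed.

Lemma mon_mx_in_Mon : in_Mon mon_mx.
Proof.
have nz i j : (mon_mx i j != 0) = (i == sigma j).
  by rewrite mxE; case: (i =P _); rewrite ?left_unit_neq0 ?eqxx.
split.
(* The inverse has the transposed support, with each [u i] replaced by its inverse [v i]. *)
- exists (\matrix_(i, j) (if j == sigma i then v i else 0)).
    apply/matrixP=> i j; rewrite !mxE (bigD1 ((sigma^-1)%g i)) //= !mxE permKV eqxx.
    rewrite big1 ?addr0 => [|k neqk]; last first.
      rewrite !mxE; case: (i =P _) neqk => [->|_ _]; last by rewrite mul0r.
      by rewrite permK eqxx.
    by rewrite (eq_sym j); case: eqP => _; rewrite ?uv ?mulr0.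
  apply/matrixP=> i j; rewrite !mxE (bigD1 (sigma i)) //= !mxE eqxx.
  rewrite (inj_eq perm_inj) big1 ?addr0 => [|k /negPf neqk]; last first.
    by rewrite !mxE neqk mul0r.
  by case: eqP => [->|_]; rewrite ?vu ?mulr0.
- move=> i; rewrite -(cards1 ((sigma^-1)%g i)); apply: eq_card => j.
  by rewrite !inE nz; apply/eqP/eqP=> ->; rewrite ?permK ?permKV.
by move=> j; rewrite -(cards1 (sigma j)); apply: eq_card => i; rewrite !inE nz.
Qed.

Lemma vec_mulmx_mon (M : bimodType R) (x : {ffun 'I_n -> M}) j :
  vec_mulmx x mon_mx j = x (sigma j) :* u j.
Proof.
rewrite ffunE (bigD1 (sigma j)) //= mxE eqxx big1 ?addr0 // => i /negPf neqi.
by rewrite mxE neqi rscaler0.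
Qed.

(** Coordinates are permuted and multiplied by units, so the zero ones correspond under [sigma]. *)
Lemma wtH_vec_mulmx_mon (M : bimodType R) (x : {ffun 'I_n -> M}) :
  wtH (vec_mulmx x mon_mx) = wtH x.
Proof.
rewrite /wtH -[RHS](card_preimset _ (@perm_inj _ sigma)); apply: eq_card => j.
rewrite !inE vec_mulmx_mon; congr (~~ _).
apply/eqP/eqP=> [xu0 | ->]; last by rewrite rscale0r.
by rewrite -[x _]rscaler1 -(uv j) -rscalerA xu0 rscale0r.
Qed.

Lemma vec_mulmx_mon_linear (M : bimodType R) :
  linear (fun x : {ffun 'I_n -> M} => vec_mulmx x mon_mx).
Proof.
move=> a x y; apply/ffunP=> j; rewrite 2![in RHS]ffunE !vec_mulmx_mon !ffunE.
by rewrite rscalerDl scaler_rscale.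
Qed.

End Monomial.

(** * Character sums and Fourier counting *)

(** Reindexing by translation with [x0] multiplies the sum by [c x0], which differs from 1. *)
Lemma sum_char (F : numDomainType) (G : finZmodType) (C : {pred G})
    (c : G -> F) x0 :
    GRing.zmod_closed C -> {in C &, forall x y, c (x + y) = c x * c y} ->
    x0 \in C -> c x0 != 1 ->
  \sum_(x in C) c x = 0.
Proof.
move=> [C0 CB] cD Cx0 cx0; set S := \sum_(x in C) c x.
have CD x : (x0 + x \in C) = (x \in C).
  apply/idP/idP=> Cx; first by rewrite -[x](addKr x0) addrC CB.
  by rewrite -[x]opprK CB // -sub0r CB.
have: S = c x0 * S.
  rewrite mulr_sumr {1}/S (reindex_inj (addrI x0)) /=.
  by apply: eq_big => [//|x]; rewrite CD => Cx; rewrite cD.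
move/eqP; rewrite -subr_eq0 -{1}[S]mul1r -mulrBl mulf_eq0 subr_eq0 eq_sym.
by rewrite (negPf cx0) => /eqP.
Qed.

Lemma sum_charT (F : numDomainType) (G : finZmodType) (c : G -> F) :
    (forall x y, c (x + y) = c x * c y) ->
  \sum_x c x = if [forall x, c x == 1] then #|G|%:R else 0.
Proof.
move=> cD; case: ifPn => [/forallP c1 | /forallPn[x0 cx0]].
  by under eq_bigr do rewrite (eqP (c1 _)); rewrite sumr_const.
by rewrite (@sum_char F G predT c x0).
Qed.

Section CharacterSums.
Variables (F : numDomainType) (R : finNzRingType) (M : finBimodType R).
Variable chi : M -> F.
Hypotheses (chi0 : chi 0 = 1) (chiD : forall x y, chi (x + y) = chi x * chi y).
Hypothesis chi_left : forall x, (forall a, chi (a *: x) = 1) -> x = 0.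

(* Summing chi (a x) and chi (x a) over R x M in both orders gives
   |R| = |M| |ann M| = |R| |{x | chi (x R) = 1}|. *)
Lemma left_generating_right :
    (forall a, (forall x, chi (a *: x) = 1) <-> (forall x : M, x :* a = 0)) ->
  forall x, (forall a, chi (x :* a) = 1) -> x = 0.
Proof.
move=> annE; pose L := [set x | [forall a, chi (x :* a) == 1]].
have sum_left : \sum_a \sum_x chi (a *: x) = #|R|%:R.
  rewrite exchange_big (bigD1 0) //= [X in _ + X]big1 ?addr0 => [|x nz_x];
    rewrite sum_charT.
  - by rewrite ifT //; apply/forallP=> a; rewrite scaler0 chi0.
  - by move=> a b; rewrite scalerDl chiD.
  - rewrite ifF //; apply: contraNF nz_x => /forallP x1.
    by apply/eqP/chi_left => a; apply/eqP.
  - by move=> a b; rewrite scalerDl chiD.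
have sum_right : \sum_a \sum_x chi (x :* a) = #|R|%:R.
  (* The inner sums agree for each [a]: [M a] is a left submodule, so [chi] is trivial on it only if
     [M a = 0], which by [annE] means that [chi] is trivial on [a M]. *)
  rewrite -sum_left; apply: eq_bigr => a _; rewrite !sum_charT.
  - congr (if _ then _ else _); apply/forallP/forallP=> a1 x; apply/eqP.
      apply: (annE a).2 => {}x; apply: chi_left => b.
      by rewrite scaler_rscale (eqP (a1 _)).
    by rewrite (annE a).1 // => y; apply/eqP.
  - by move=> x y; rewrite scalerDr chiD.
  - by move=> x y; rewrite rscalerDl chiD.
have R0 : #|R|%:R != 0 :> F by rewrite pnatr_eq0 -lt0n; apply/card_gt0P; exists 0.
(* Summing over [a] first, each [x] in [L] contributes [#|R|] and every other [x] nothing; hence [L]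
   is a singleton, and it contains 0. *)
have/eqP: #|R|%:R *+ #|L| = #|R|%:R :> F.
  rewrite -[RHS]sum_right exchange_big -sumr_const big_mkcond /=.
  apply: eq_bigr => x _; rewrite inE sum_charT // => a b.
  by rewrite rscalerDr chiD.
rewrite -mulr_natr -subr_eq0 -{2}[_%:R]mulr1 -mulrBr mulf_eq0 (negPf R0) /=.
rewrite subr_eq0 pnatr_eq1 => /cards1P[z Lz] x x1.
have : x \in L by rewrite inE; apply/forallP=> a; rewrite x1.
have : 0 \in L by rewrite inE; apply/forallP=> a; rewrite rscale0r chi0.
by rewrite Lz !inE => /eqP-> /eqP.
Qed.

Variables (V : finLmodType R) (C : {pred V}).
Hypothesis submodC : GRing.submod_closed C.
Hypothesis chi_right : forall x, (forall a, chi (x :* a) = 1) -> x = 0.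

(** This encodes the homomorphisms from [C] to [M]. Extension by zero makes equality of functions
    coincide with equality on [C]. *)
Definition hom_on (h : {ffun V -> M}) :=
  (forall a, {in C &, forall u v, h (a *: u + v) = a *: h u + h v}) /\
  (forall v, v \notin C -> h v = 0).

(** If [h v] is nonzero, [chi] is nontrivial on the left submodule it generates, so [chi \o h] is a
    nontrivial character of [C]. *)
Lemma sum_char_hom h : hom_on h ->
  \sum_(v in C) chi (h v) = if h == 0 then #|C|%:R else 0.
Proof.
case=> [hlin hout]; case: eqP => [-> | nz_h].
  by under eq_bigr do rewrite ffunE chi0; rewrite sumr_const.
have [v /andP[Cv hv]] : exists v, (v \in C) && (h v != 0).
  apply/existsP; apply: contra_notT nz_h => /existsPn h0; apply/ffunP=> v.
  have [Cv | /hout->] := boolP (v \in C); last by rewrite ffunE.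
  by move: (h0 v); rewrite Cv negbK ffunE => /eqP.
have [a a1] : exists a, chi (a *: h v) != 1.
  apply/existsP; apply: contraNT hv => /existsPn h1; apply/eqP/chi_left => a.
  by apply/eqP; rewrite -[_ == _]negbK h1.
have hZ : h (a *: v) = a *: h v.
  have h0 : h 0 = 0.
    have := hlin 1 0 0 submodC.1 submodC.1.
    by rewrite !scale1r addr0 -{1}[h 0]addr0 => /addrI.
  by have := hlin a v 0 Cv submodC.1; rewrite h0 !addr0.
apply: (@sum_char _ _ _ (chi \o h) (a *: v)) => /=.
- exact: GRing.submod_closedB.
- by move=> x y Cx Cy; have := hlin 1 x y Cx Cy; rewrite !scale1r => ->.
- by have := submodC.2 a v 0 Cv submodC.1; rewrite addr0.
- by rewrite hZ.
Qed.

Lemma hom_on_rscaleB (l h : {ffun V -> M}) r :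
  hom_on l -> hom_on h -> hom_on (l :* r - h).
Proof.
move=> [llin lout] [hlin hout]; split=> [a u v Cu Cv | v nCv].
  rewrite !ffunE llin // hlin // rscalerDl -scaler_rscale scalerDr scalerN.
  by rewrite opprD addrACA.
by rewrite !ffunE lout // hout // rscale0r subr0.
Qed.

(** The indicator of [l i :* r = h], times [#|C|], is the sum over [C] of [chi (l i v :* r - h v)].
    Summing over [r] first detects [l i v = 0], so only numbers of zero coordinates remain. *)
Lemma fourier_count n (l : 'I_n -> {ffun V -> M}) h :
    (forall i, hom_on (l i)) -> hom_on h ->
  (\sum_i #|[set r | l i :* r == h]|)%:R * #|C|%:R =
  \sum_(v in C) chi (- h v) * (#|R| * #|[set i | l i v == 0]|)%:R.
Proof.
move=> hl hh; rewrite natr_sum mulr_suml.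
transitivity (\sum_i \sum_r \sum_(v in C) chi (- h v) * chi (l i v :* r)).
  apply: eq_bigr => i _; rewrite -sum1dep_card natr_sum mulr_suml big_mkcond /=.
  apply: eq_bigr => r _; rewrite -subr_eq0 mul1r.
  rewrite -(sum_char_hom (hom_on_rscaleB r (hl i) hh)).
  by apply: eq_bigr => v _; rewrite !ffunE addrC chiD.
under eq_bigr do rewrite exchange_big; rewrite exchange_big /=.
apply: eq_bigr => v _; under eq_bigr do rewrite -mulr_sumr.
rewrite -mulr_sumr; congr (_ * _); rewrite mulnC natrM mulr_natl.
rewrite -sumr_const [RHS]big_mkcond; apply: eq_bigr => i _.
rewrite sum_charT => [|r s]; last by rewrite rscalerDr chiD.
rewrite inE; congr (if _ then _ else _); apply/forallP/eqP => [l1 | -> r].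
  by apply: chi_right => r; apply/eqP.
by rewrite rscale0r chi0.
Qed.

End CharacterSums.

(** * The generating character of a Frobenius bimodule *)

Section CharacterEvaluation.
Variables (K : realType) (R : finNzRingType).
Implicit Types (chi psi : char_group K R) (a r : R).

Lemma char_zeroE a : (0 : char_group K R) a = 1.
Proof. exact: ffunE. Qed.

Lemma char_addE chi psi a : (chi + psi) a = chi a * psi a.
Proof. exact: ffunE. Qed.

Lemma char_scaleE r chi a : (r *: chi) a = chi (a * r).
Proof. exact: ffunE. Qed.

Lemma char_rscaleE chi r a : (chi :* r) a = chi (r * a).
Proof. exact: ffunE. Qed.

End CharacterEvaluation.

(** Since [chi (a *: x) = phi x a], injectivity of [phi] settles the left side. For the right side,
    [chi] trivial on [a M] (via [phi]) and [M a = 0] (via [psi]) both say that every character of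
    [R] is trivial at [a]. *)
Lemma frobenius_character (K : realType) (R : finNzRingType) (M : finBimodType R) :
    frobenius_bimodule K M ->
  exists chi : M -> K[i]%C,
    [/\ chi 0 = 1, forall x y, chi (x + y) = chi x * chi y,
        forall x, (forall a, chi (a *: x) = 1) -> x = 0
      & forall x, (forall a, chi (x :* a) = 1) -> x = 0].
Proof.
case=> -[phi bij_phi] [psi bij_psi psiZ].
pose chi x := phi x 1.
have chiE a x : chi (a *: x) = phi x a by rewrite /chi linearZ char_scaleE mul1r.
have chi0 : chi 0 = 1 by rewrite /chi linear0 char_zeroE.
have chiD x y : chi (x + y) = chi x * chi y by rewrite /chi linearD char_addE.
have chiL x : (forall a, chi (a *: x) = 1) -> x = 0.
  move=> x1; apply: (bij_inj bij_phi); rewrite linear0; apply: Defs.charP => a.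
  by rewrite -chiE x1 char_zeroE.
exists chi; split=> //; apply: left_generating_right => // a; split=> a1 x.
  apply: (bij_inj bij_psi); rewrite psiZ raddf0; apply: Defs.charP => b.
  have [phi' _ phiK] := bij_phi.
  rewrite char_rscaleE char_zeroE -[psi x _]char_scaleE.
  by rewrite -(phiK (b *: psi x)) -chiE a1.
have [psi' _ psiK] := bij_psi.
rewrite chiE -(psiK (phi x)) -[a]mulr1.
transitivity ((psi (psi' (phi x)) :* a) 1); first by rewrite char_rscaleE.
by rewrite -psiZ a1 raddf0 char_zeroE.
Qed.

(** * Weight-preserving maps are monomial *)

Lemma hamming_monomial (K : realType) (R : finNzRingType) (M : finBimodType R)
    (hM : frobenius_bimodule K M) (n : nat)
    (C : {pred {ffun 'I_n -> M}}) (f : {ffun 'I_n -> M} -> {ffun 'I_n -> M}) :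
    GRing.submod_closed C -> linear_on C f ->
    preserving_on (hamming_weight K M n) C f ->
  exists (sigma : {perm 'I_n}) (u v : 'I_n -> R),
    [/\ forall j, u j * v j = 1, forall j, v j * u j = 1
      & {in C, forall x, f x = vec_mulmx x (mon_mx sigma u)}].
Proof.
move=> submodC flin fwt; have [chi [chi0 chiD chiL chiR]] := frobenius_character hM.
(* Coordinate functions on [C], extended by zero as [hom_on] demands. *)
pose restr (g : {ffun 'I_n -> M} -> {ffun 'I_n -> M}) i :
    {ffun {ffun 'I_n -> M} -> M} :=
  [ffun x => if x \in C then g x i else 0].
have hom_restr g i : linear_on C g -> hom_on C (restr g i).
  move=> glin; split=> [a x y Cx Cy | x /negPf nCx]; last by rewrite ffunE nCx.
  by rewrite !ffunE Cx Cy submodC.2 // glin // !ffunE.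
have hom_id i : hom_on C (restr id i) by apply: hom_restr => a x y.
have hom_f i : hom_on C (restr f i) by apply: hom_restr.
have C0 : #|C|%:R != 0 :> K[i]%C.
  by rewrite pnatr_eq0 -lt0n; apply/card_gt0P; exists 0; apply: submodC.1.
have zerosE (x : {ffun 'I_n -> M}) : #|[set i | x i == 0]| = (n - wtH x)%N.
  rewrite cardsCs card_ord; congr (_ - _)%N.
  by apply: eq_card => i; rewrite !inE.
have [|sigma [u [v uvP]]] := @rspan_family_unit R _ n (restr id) (restr f).
  (* The counts are compared in [K[i]] after multiplication by the nonzero [#|C|]. Their Fourier
     expansions agree termwise, since equal weights of [x] and [f x] mean equally many zeros. *)
  move=> h Ph; apply/eqP; rewrite -(eqr_nat K[i]%C) -(inj_eq (mulIf C0)); apply/eqP.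
  have hh : hom_on C h by case: Ph => -[i ->].
  rewrite !(fourier_count chi0 chiD chiL submodC chiR) //; apply: eq_bigr => x Cx.
  congr (_ * (_ * _)%:R).
  transitivity #|[set i | x i == 0]|.
    by apply: eq_card => i; rewrite !inE ffunE Cx.
  transitivity #|[set i | f x i == 0]|; last first.
    by apply: eq_card => i; rewrite !inE ffunE Cx.
  by have /eqP := fwt x Cx; rewrite !zerosE eqr_nat => /eqP->.
exists sigma, u, v; split=> [j|j|x Cx]; try by case: (uvP j).
apply/ffunP=> j; rewrite vec_mulmx_mon.
by have [/ffunP/(_ x) + _ _] := uvP j; rewrite !ffunE Cx.
Qed.

Theorem theorem4p15 (K : realType) (R : finNzRingType) (M : finBimodType R)
    (hM : frobenius_bimodule K M) (n : nat) :
  MacWilliams_extension (hamming_weight K M n) /\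
  (forall (C : {pred {ffun 'I_n -> M}}) (f : {ffun 'I_n -> M} -> {ffun 'I_n -> M}),
     GRing.submod_closed C -> linear_on C f ->
     preserving_on (hamming_weight K M n) C f ->
   exists2 A : 'M[R]_n, in_Mon A & {in C, forall v, f v = vec_mulmx v A}).
Proof.
split=> C f submodC flin fwt;
  have [sigma [u [v [uv vu fE]]]] := hamming_monomial hM submodC flin fwt.
  (* Right multiplication by the monomial matrix is left linear and weight-preserving on all of
     [M^n], so it is the required extension. *)
  pose g x := vec_mulmx x (mon_mx sigma u) : {ffun 'I_n -> M}.
  pose gL := GRing.isLinear.Build R _ _ _ g (vec_mulmx_mon_linear sigma u (M := M)).
  pose G : {linear {ffun 'I_n -> M} -> {ffun 'I_n -> M}} := HB.pack g gL.
  exists G => [x Cx | x]; first by rewrite fE.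
  by rewrite /= (wtH_vec_mulmx_mon sigma uv).
by exists (mon_mx sigma u) => //; apply: mon_mx_in_Mon uv vu.
Qed.
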